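(* Let $0<\beta<1$ and $\lambda>0$. The one-dimensional distributions of the fractional Poisson process $\{N_\beta(t,\lambda)\}_{t\ge 0}$ are not infinitely divisible; that is, for every $t>0$ the distribution of $N_\beta(t,\lambda)$ is not infinitely divisible.
   Context: Let $\{D_\beta(t)\}_{t\ge0}$ be the $\beta$-stable subordinator, $\mathbb{E}[e^{-sD_\beta(t)}]=e^{-ts^\beta}$ for $s\ge 0$, and let $E_\beta(t)=\inf\{s>0: D_\beta(s)>t\}$ be its inverse. Let $\{N(t,\lambda)\}_{t\ge0}$ be a Poisson process of rate $\lambda$ independent of $\{E_\beta(t)\}_{t\ge 0}$. The fractional Poisson process (FPP) $\{N_\beta(t,\lambda)\}_{t\ge0}$ can be realized as $N_\beta(t,\lambda)=N(E_\beta(t),\lambda)$; its one-dimensional distributions are, for $n=0,1,2,\ldots$, $$\mathbb{P}[N_\beta(t,\lambda)=n]=\frac{(\lambda t^{\beta})^n}{n!}\sum_{k=0}^{\infty}\frac{(n+k)!}{k!}\frac{(-\lambda t^{\beta})^k}{\Gamma(\beta(k+n)+1)}.$$ *)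

(* Defs.v *)
From HB Require Import structures.
From mathcomp Require Export all_boot all_order all_algebra.
From mathcomp Require Export all_classical all_reals all_analysis.

Set Implicit Arguments.
Unset Strict Implicit.
Unset Printing Implicit Defensive.

Import Order.TTheory GRing.Theory Num.Theory.
Import numFieldNormedType.Exports.

Local Open Scope classical_set_scope.
Local Open Scope ring_scope.

(* Real-valued stochastic processes are families [X : R -> {RV P >-> R}]; only
   the times [t >= 0] are ever looked at. *)

Section Independence.
Context {R : realType} {d : measure_display} {T : measurableType d}.
Variable P : probability T R.

(* Some of the [B i] may be [setT], so the product rule for the full family
   contains the product rule for every subfamily. *)
Definition mutually_independent (n : nat) (Y : 'I_n -> T -> R) : Prop :=
  forall B : 'I_n -> set R, (forall i, measurable (B i)) ->
    P [set w | forall i, B i (Y i w)] =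
    (\prod_(i < n) P [set w | B i (Y i w)])%E.

(* Independence of the sigma-algebras generated by two processes, tested on the
   generating pi-systems of finite-dimensional cylinders. *)
Definition independent_processes (X Y : R -> T -> R) : Prop :=
  forall (m n : nat) (s : 'I_m -> R) (t : 'I_n -> R)
         (A : 'I_m -> set R) (B : 'I_n -> set R),
    (forall i, 0 <= s i) -> (forall j, 0 <= t j) ->
    (forall i, measurable (A i)) -> (forall j, measurable (B j)) ->
    P ([set w | forall i, A i (X (s i) w)] `&`
       [set w | forall j, B j (Y (t j) w)]) =
    (P [set w | forall i, A i (X (s i) w)] *
     P [set w | forall j, B j (Y (t j) w)])%E.

End Independence.

Section Processes.
Context {R : realType} {d : measure_display} {T : measurableType d}.
Variable P : probability T R.

Definition cadlag (f : R -> R) : Prop :=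
  (forall t, 0 <= t -> f x @[x --> t^'+] --> f t) /\
  (forall t, 0 < t -> cvg (f x @[x --> t^'-])).

Definition independent_increments (X : R -> {RV P >-> R}) : Prop :=
  forall (n : nat) (t : nat -> R), 0 <= t 0%N -> (forall i, t i <= t i.+1) ->
    mutually_independent P (fun (i : 'I_n) w => X (t i.+1) w - X (t i) w).

Definition stationary_increments (X : R -> {RV P >-> R}) : Prop :=
  forall (s h : R) (B : set R), 0 <= s -> 0 <= h -> measurable B ->
    P [set w | B (X (s + h) w - X s w)] = P [set w | B (X h w)].

(* Path properties are imposed on every path rather than on almost every path.
   Since only laws matter below, this loses nothing (change the process on a
   null set), and it makes the inverse of a subordinator, and processes
   time-changed by it, measurable. *)
Definition levy_process (X : R -> {RV P >-> R}) : Prop :=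
  [/\ forall w, X 0 w = 0,
      independent_increments X,
      stationary_increments X &
      forall w, cadlag (X ^~ w)].

Definition subordinator (D : R -> {RV P >-> R}) : Prop :=
  levy_process D /\
  forall w s t, 0 <= s -> s <= t -> D s w <= D t w.

Definition stable_subordinator (beta : R) (D : R -> {RV P >-> R}) : Prop :=
  subordinator D /\
  forall t s : R, 0 <= t -> 0 <= s ->
    ('E_P[fun w => expR (- s * D t w)] = (expR (- t * s `^ beta))%:E)%E.

(* [inf set0 = 0], which can only occur on the null event where the path of [D]
   is bounded. *)
Definition inverse_subordinator (D : R -> T -> R) (t : R) (w : T) : R :=
  inf [set s | 0 < s /\ t < D s w].

(* [poisson_pmf] is a probability mass function for positive rates only, hence
   [0 < t]; [N 0 = 0] is part of [levy_process]. *)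
Definition poisson_process (lambda : R) (N : R -> {RV P >-> R}) : Prop :=
  levy_process N /\
  forall (t : R) (k : nat), 0 < t ->
    P [set w | N t w = k%:R] = (poisson_pmf (lambda * t) k)%:E.

End Processes.

Definition same_fdd {R : realType} {d d' : measure_display}
    {T : measurableType d} {T' : measurableType d'}
    (P : probability T R) (P' : probability T' R)
    (X : R -> T -> R) (X' : R -> T' -> R) : Prop :=
  forall (n : nat) (t : 'I_n -> R) (B : 'I_n -> set R),
    (forall i, 0 <= t i) -> (forall i, measurable (B i)) ->
    P [set w | forall i, B i (X (t i) w)] =
    P' [set w | forall i, B i (X' (t i) w)].

(* [X] is equal in law to the process [N (E_beta t)], which may live on another
   probability space. *)
Definition fractional_poisson_process {R : realType} (beta lambda : R)
    {d : measure_display} {T : measurableType d} (P : probability T R)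
    (X : R -> {RV P >-> R}) : Prop :=
  exists (d' : measure_display) (T' : measurableType d')
         (P' : probability T' R) (D N : R -> {RV P' >-> R}),
    [/\ stable_subordinator beta D,
        poisson_process lambda N,
        independent_processes P' N (inverse_subordinator D) &
        same_fdd P P' X (fun t w => N (inverse_subordinator D t w) w)].

Definition infinitely_divisible {R : realType}
    (mu : probability R R) : Prop :=
  forall n : nat, (0 < n)%N ->
    exists (d : measure_display) (T : measurableType d) (Q : probability T R)
           (Y : 'I_n -> {RV Q >-> R}),
      [/\ mutually_independent Q Y,
          forall (i j : 'I_n) (B : set R), measurable B ->
            distribution Q (Y i) B = distribution Q (Y j) B &
          forall B : set R, measurable B ->
            mu B = Q [set w | B (\sum_(i < n) Y i w)]].

(* Main.v *)
Require Import Defs.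
From mathcomp Require Import ring lra measurable_realfun.
From mathcomp.real_closed Require Import polyrcf.

(** Write E for the inverse subordinator at time t, so that the value of the
    process at t has the law of N(E) with N an independent Poisson process of
    rate lambda.  It is a mixed Poisson law on the natural numbers, with
    generating function G(u) equal to the mean of exp (lambda (u - 1) E)
    ([subordinated_law], [mixed_poisson_gen_fun]).  The tail of E is lighter
    than any exponential, so G is defined, and positive, on the whole real line.

    Suppose that this law is infinitely divisible.  For every n it is the n-fold
    convolution of a law on the natural numbers
    ([infinitely_divisible_conv_root]), that is G = g ^ n for a power series g
    with nonnegative coefficients, and for odd n this gives
    g = exp ((ln G) / n) on the negative axis as well.  As n grows,
    n (g u - g 0) tends to ln (G u) - ln (G 0), so ln G is a limit of power
    series whose nonconstant coefficients are nonnegative.  Moreover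
    ln (G u) is O(u ^ K) as u goes to +oo, K being an integer above 1 / beta
    ([mgf_inverse_le]); together with the nonnegativity this kills all
    coefficients beyond the K-th in the limit, so that ln G is a polynomial,
    on the negative axis too ([ln_gen_fun_poly]).

    Hence the logarithm of the Laplace transform of E is a polynomial on the
    positive half-line.  But it is nonpositive, and it decreases slower than any
    linear function, because E is below any given e > 0 with positive
    probability; a polynomial with these two properties is constant
    ([sublinear_poly_const]).  Then E = 0 almost surely, so that the
    subordinator passes the level t immediately, which it does not
    ([mgf_inverse_not_exp_poly]). *)

Set Implicit Arguments.
Unset Strict Implicit.
Unset Printing Implicit Defensive.
Import Order.TTheory GRing.Theory Num.Theory.
Import numFieldNormedType.Exports.
Local Open Scope classical_set_scope.
Local Open Scope ring_scope.

(** * Polynomials of sublinear growth and limits along ultrafilters *)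

(** The slope bound by e for every e rules out degree one as well, not only the
    degrees above: with half the leading coefficient as slope, the difference
    still has a positive leading coefficient, and so is eventually positive. *)
Lemma sublinear_poly_const (R : realType) (p : {poly R}) :
  (forall x, 0 <= x -> 0 <= p.[x]) ->
  (forall e, 0 < e -> exists C, forall x, 0 <= x -> p.[x] <= C + e * x) ->
  (size p <= 1)%N.
Proof.
move=> p0 pe; rewrite leqNgt; apply/negP => sp.
have lp0 : lead_coef p != 0 by rewrite lead_coef_eq0 -size_poly_gt0 (ltn_trans _ sp).
have [lp|lp] := ltP 0 (lead_coef p); last first.
  have lpN : 0 < lead_coef (- p) by rewrite lead_coefN oppr_gt0 lt_neqAle lp0.
  have [n /(_ (Num.max 0 n))] := poly_pinfty_gt_lc lpN.
  rewrite le_max lexx orbT => /(_ isT).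
  have := p0 (Num.max 0 n); rewrite le_max lexx => /(_ isT).
  by rewrite hornerN; lra.
have [C HC] := pe (lead_coef p / 2) ltac:(lra).
pose r := p - (lead_coef p / 2) *: 'X - C%:P.
have lr : 0 < lead_coef r.
  have e : r = p - ((lead_coef p / 2) *: 'X + C%:P) by rewrite /r opprD addrA.
  have s2 : (size ((lead_coef p / 2) *: 'X + C%:P)%R <= 2)%N.
    apply: (leq_trans (size_polyD _ _)); rewrite geq_max.
    rewrite (leq_trans (size_scale_leq _ _)) ?size_polyX//=.
    by rewrite (leq_trans (size_polyC_leq1 _)).
  have [sp2|sp2] := ltnP 2 (size p).
    by rewrite e lead_coefDl// size_polyN (leq_ltn_trans s2).
  have sp2' : size p = 2 by apply/eqP; rewrite eqn_leq sp2.
  have r1 : r`_1 = lead_coef p / 2.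
    rewrite /r !coefB coefZ coefX coefC /= subr0 lead_coefE sp2' /=; lra.
  have sr : (size r <= 2)%N.
    by rewrite e (leq_trans (size_polyD _ _))// geq_max sp2' size_polyN s2.
  have -> : lead_coef r = r`_1.
    rewrite lead_coefE; have : (1 < size r)%N.
      rewrite ltnNge; apply/negP => sr1; have : r`_1 = 0 by rewrite nth_default.
      by rewrite r1; lra.
    by case: (size r) sr => [|[|[|]]].
  by rewrite r1; lra.
have [n /(_ (Num.max 0 n))] := poly_pinfty_gt_lc lr.
rewrite le_max lexx orbT => /(_ isT).
have := HC (Num.max 0 n); rewrite le_max lexx => /(_ isT).
by rewrite /r !hornerE; lra.
Qed.

(** Taking limits along an ultrafilter replaces the extraction of a
    subsequence along which countably many coefficients converge. *)
Lemma compact_ultra_cvg (T : Type) (X : topologicalType) (U : set_system T)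
    (f : T -> X) (A : set X) :
  UltraFilter U -> compact A -> U (f @^-1` A) -> exists x : X, f @ U --> x.
Proof.
move=> UU cA UA.
have PU : ProperFilter U by exact: ultra_proper.
have [x [Ax clx]] := cA (f @ U) _ UA.
exists x => V Vx; have [//|UVC] := in_ultra_setVsetC (f @^-1` V) UU.
by have [y [/= nVy Vy]] := clx (~` V) V UVC Vx.
Qed.

(** * Generating functions and convolution roots *)

Section GeneratingFunction.
Context {R : realType}.
Implicit Types (p q : nat -> R) (G : R -> R).

Definition gen_fun p G :=
  forall u, series (fun m => p m * u ^+ m) @ \oo --> G u.

(** This expresses that the n-th convolution power of q is p, in terms of the
    truncations of q: below the order of truncation the coefficients of the
    power are exact, and above it they only miss nonnegative terms. *)
Definition conv_root p n q :=
  forall M m, 0 <= ((\poly_(k < M) q k) ^+ n)`_m <= p m /\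
    ((m < M)%N -> ((\poly_(k < M) q k) ^+ n)`_m = p m).

Lemma gen_fun_ge p G v M : (forall m, 0 <= p m) -> gen_fun p G -> 0 <= v ->
  series (fun m => p m * v ^+ m) M <= G v.
Proof.
move=> p0 pG v0; rewrite -(cvg_lim _ (pG v))//.
apply: nondecreasing_cvgn_le; last by apply/cvg_ex; exists (G v); exact: pG.
by apply: nondecreasing_series => k _ _; rewrite mulr_ge0// exprn_ge0.
Qed.

Lemma gen_fun0 p G : gen_fun p G -> G 0 = p 0%N.
Proof.
move=> /(_ 0) pG; apply: (cvg_unique _ pG) => //.
apply: cvg_near_cst; near=> M.
have -> : M = M.-1.+1 by rewrite prednK//; near: M; exact: nbhs_infty_gt.
rewrite /series/= big_nat_recl//= expr0 mulr1 big1 ?addr0// => i _.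
by rewrite expr0n mulr0.
Unshelve. all: by end_near. Qed.

(** The n-th power of a partial sum of q is a partial sum of p up to terms of
    order at least M, whose coefficients lie between 0 and those of p; the error
    is thus bounded by the tail of the series of p at |u|, for negative u too. *)
Lemma conv_root_cvg_exp p G n q u : gen_fun p G -> conv_root p n q ->
  series (fun k => q k * u ^+ k) M ^+ n @[M --> \oo] --> G u.
Proof.
move=> pG rt.
have p0 m : 0 <= p m by have [/andP[c0 c1] _] := rt 0%N m; exact: le_trans c1.
pose S v := series (fun m => p m * v ^+ m).
suff key M : `|series (fun k => q k * u ^+ k) M ^+ n - S u M| <= G `|u| - S `|u| M.
  have : S u M + (series (fun k => q k * u ^+ k) M ^+ n - S u M) @[M --> \oo] --> G u + 0.
    apply: cvgD; first exact: pG.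
    apply/norm_cvg0P; apply: (@squeeze_cvgr _ _ _ _ (cst 0) (fun M => G `|u| - S `|u| M)).
    - by near=> M; rewrite key normr_ge0.
    - exact: cvg_cst.
    - by rewrite -[X in _ --> X](subrr (G `|u|)); apply: cvgB; [exact: cvg_cst|exact: pG].
  by rewrite addr0; apply: cvg_trans; apply: near_eq_cvg; near=> M; rewrite addrC subrK.
set Q := \poly_(k < M) q k.
have -> : series (fun k => q k * u ^+ k) M = Q.[u].
  by rewrite horner_poly /series/= big_mkord.
pose L := (M + size (Q ^+ n))%N.

have ML : (M <= L)%N by exact: leq_addr.
rewrite -horner_exp (@horner_coef_wide _ L); last exact: leq_addl.
rewrite -(big_mkord xpredT (fun m => (Q ^+ n)`_m * u ^+ m)).
rewrite (big_cat_nat (leq0n M) ML)//= (_ : \sum_(0 <= i < M) _ = S u M); last first.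
  by apply: eq_big_nat => m /andP[_ mM]; congr (_ * _); exact: (rt M m).2.
rewrite addrAC subrr add0r (le_trans (ler_norm_sum _ _ _))//.
apply: (@le_trans _ _ (S `|u| L - S `|u| M)); last first.
  by rewrite lerB// gen_fun_ge.
rewrite /S /series/= (big_cat_nat (leq0n M) ML)//= addrAC subrr add0r ler_sum// => m _.
have /andP[c0 cp] := (rt M m).1.
by rewrite normrM normrX (ger0_norm c0) ler_wpM2r// exprn_ge0.
Unshelve. all: by end_near. Qed.

(** Oddness of n makes the positive root the only real one, so that the sign of
    the series of q is known even where u is negative. *)
Lemma conv_root_gen_fun p G n q : gen_fun p G -> (forall u, 0 < G u) ->
  odd n -> conv_root p n q -> gen_fun q (fun u => expR (ln (G u) / n%:R)).
Proof.
move=> pG G0 on rt u.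
have n0 : n%:R != 0 :> R by rewrite pnatr_eq0 -lt0n odd_gt0.
have h := conv_root_cvg_exp (u := u) pG rt.
have hl : expR (ln (series (fun k => q k * u ^+ k) M ^+ n) / n%:R) @[M --> \oo] -->
    expR (ln (G u) / n%:R).
  apply: continuous_cvg; first exact: continuous_expR.
  apply: cvgM; last exact: cvg_cst.
  by apply: continuous_cvg => //; exact: continuous_ln.
apply: cvg_trans hl; apply: near_eq_cvg.
near=> M; have : 0 < series (fun k => q k * u ^+ k) M ^+ n.
  by near: M; exact: (cvgr_gt _ h).
by rewrite exprn_odd_gt0// => F0; rewrite lnXn// -(mulr_natr (ln _)) mulfK// lnK.
Unshelve. all: by end_near. Qed.

(** As the coefficients are nonnegative, the tail at u is compared term by term
    with the values at a larger y, gaining a power of |u| / y. *)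
Lemma gen_fun_tail q g K u y : (forall k, 0 <= q k) -> gen_fun q g ->
  0 < y -> `|u| <= y ->
  `|g u - series (fun k => q k * u ^+ k) K.+1| <=
    (`|u| / y) ^+ K.+1 * (g y - g 0).
Proof.
move=> q0 qg y0 uy; rewrite (gen_fun0 qg).
have ulim : `|series (fun k => q k * u ^+ k) M - series (fun k => q k * u ^+ k) K.+1|
    @[M --> \oo] --> `|g u - series (fun k => q k * u ^+ k) K.+1|.
  by apply: cvg_norm; apply: cvgB; [exact: qg|exact: cvg_cst].
apply: (cvgr_to_le ulim); near=> M.
have KM : (K.+1 <= M)%N by near: M; exact: nbhs_infty_ge.
have M0 : (0 < M)%N by exact: leq_ltn_trans KM.
apply: (@le_trans _ _ ((`|u| / y) ^+ K.+1 *
    (series (fun k => q k * y ^+ k) M - q 0%N))); last first.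
  by rewrite ler_wpM2l ?exprn_ge0 ?divr_ge0 ?(ltW y0)// lerB// gen_fun_ge// ltW.
rewrite /series/= (big_cat_nat (leq0n K.+1) KM)//= addrAC subrr add0r.
rewrite (le_trans (ler_norm_sum _ _ _))//.
rewrite (big_ltn M0) expr0 mulr1 addrAC subrr add0r.
rewrite (@big_cat_nat _ _ _ K.+1 1 M)//= mulrDr.
apply: (@le_trans _ _ ((`|u| / y) ^+ K.+1 * \sum_(K.+1 <= i < M) q i * y ^+ i)); last first.
  rewrite lerDr mulr_ge0 ?exprn_ge0 ?divr_ge0 ?(ltW y0)// sumr_ge0// => i _.
  by rewrite mulr_ge0// exprn_ge0// ltW.
rewrite mulr_sumr; apply: ler_sum_nat => k /andP[Kk _].
rewrite normrM (ger0_norm (q0 _)) normrX mulrCA ler_wpM2l//.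
rewrite -[leLHS](@divfK _ (y ^+ k)) ?expf_neq0 ?gt_eqF// -expr_div_n.
rewrite ler_wpM2r ?exprn_ge0 ?(ltW y0)//; apply: ler_wiXn2l => //.
- by rewrite divr_ge0// ltW.
- by rewrite ler_pdivrMr// mul1r.
Unshelve. all: by end_near. Qed.

(** The derivative of x |-> expR (a * x) - expR (b * x) at 0, taken along the
    inverses of the odd integers: only odd convolution roots are used. *)
Lemma cvg_mul_expR_sub (a b : R) :
  j.*2.+1%:R * (expR (a / j.*2.+1%:R) - expR (b / j.*2.+1%:R)) @[j --> \oo] --> a - b.
Proof.
suff key (c : R) : j.*2.+1%:R * (expR (c / j.*2.+1%:R) - 1) @[j --> \oo] --> c.
  rewrite [X in X @ _ --> _](_ : _ = fun j => j.*2.+1%:R * (expR (a / j.*2.+1%:R) - 1) -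
    j.*2.+1%:R * (expR (b / j.*2.+1%:R) - 1)); first exact: cvgB.
  by apply/funext => j; ring.
have hinv : j.*2.+1%:R^-1 @[j --> \oo] --> (0 : R).
  apply: (@cvg_comp _ _ _ double (@harmonic R) _ _ _ _ cvg_harmonic).
  move=> A [N _ NA]; exists N => // j /= Nj; apply: NA => /=.
  by rewrite (leq_trans Nj)// -addnn leq_addr.
have hexp : c * expR (c / j.*2.+1%:R) @[j --> \oo] --> c.
  rewrite -[X in _ --> X]mulr1; apply: cvgM; first exact: cvg_cst.
  rewrite [X in _ --> X](_ : 1 = expR (c * 0)); last by rewrite mulr0 expR0.
  apply: continuous_cvg; first exact: continuous_expR.
  by apply: cvgM => //; exact: cvg_cst.
apply: (@squeeze_cvgr _ _ _ _ (cst c) _ _ _ _ _ hexp); last exact: cvg_cst.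
near=> j; rewrite /=; set n := j.*2.+1%:R; have n0 : 0 < n :> R by rewrite ltr0n.
set x := c / n; have nc : n * x = c by rewrite mulrC divfK ?gt_eqF.
clearbody x; rewrite -nc -mulrA !ler_pM2l//.
have h1 := expR_ge1Dx x; have h2 := expR_ge1Dx (- x).
have := expR_gt0 x; have : expR x * expR (- x) = 1 by rewrite expRxMexpNx_1.
move: (expR _) (expR _) h1 h2 => y z h1 h2 xy x0.
by apply/andP; split; nra.
Unshelve. all: by end_near. Qed.

(** Along an ultrafilter, for k > 0, the coefficients [j.*2.+1%:R * q j k]
    converge to some [r k].  The tail estimate passes to the limit and bounds the distance
    between ln (G u) - ln (G 0) and the polynomial of the [r k] with 0 < k <= K by
    (|u| / y) ^ (K + 1) times O(y ^ K), for every large y; hence by 0. *)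
Lemma ln_gen_fun_poly p G K C : gen_fun p G -> (forall u, 0 < G u) ->
  (forall y, 0 <= y -> ln (G y) <= C * (1 + y) ^+ K) ->
  (forall j, exists q, (forall k, 0 <= q k) /\ conv_root p j.*2.+1 q) ->
  exists r : {poly R}, forall u, ln (G u) = r.[u].
Proof.
move=> pG G0 GK /choice[q qrt].
have q0 j k : 0 <= q j k by have [] := qrt j.
pose g j u := expR (ln (G u) / j.*2.+1%:R).
have qg j : gen_fun (q j) (g j).
  by apply: conv_root_gen_fun => //; [rewrite /= odd_double|exact: (qrt j).2].
pose H u := ln (G u) - ln (G 0).
pose D j u := j.*2.+1%:R * (g j u - g j 0).
have DH u : D j u @[j --> \oo] --> H u by exact: cvg_mul_expR_sub.
have [U [UU ooU]] := ultraFilterLemma (@eventually_filter).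
have PU : ProperFilter U by exact: ultra_proper.
have DHU u : D j u @[j --> U] --> H u.
  by move=> V /DH; exact: ooU.
pose a j k : R := if k is 0%N then 0 else j.*2.+1%:R * q j k.
have a_cvg k : exists r : R, a j k @[j --> U] --> r.
  apply: (@compact_ultra_cvg _ _ _ _ `[0, H 1 + 1]%classic) => //.
    exact: segment_compact.
  (* A coefficient is at most the increment of the series between 0 and 1. *)
  apply: ooU; have : H 1 < H 1 + 1 by lra.
  have := DH 1; move=> /cvgr_le/[apply]; apply: filterS => j Dj /=; rewrite in_itv/=.
  have aD : a j k <= D j 1.
    rewrite /D; case: k => [|k] /=.
      rewrite mulr_ge0// subr_ge0 (gen_fun0 (qg j)).
      have := gen_fun_ge 1%N (q0 j) (qg j) ler01.
      by rewrite /series/= big_nat1 expr0 mulr1.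
    rewrite ler_pM2l ?ltr0n// lerBrDr (gen_fun0 (qg j)).
    apply: le_trans (gen_fun_ge k.+2 (q0 j) (qg j) ler01).
    rewrite /series/= big_nat_recr//= big_nat_recl//= expr1n !mulr1 addrC expr1n mulr1 lerD2l.
    by rewrite lerDl sumr_ge0// => i _; rewrite expr1n mulr1.
  rewrite (le_trans aD Dj) andbT; case: k aD => //= k _.
  by rewrite mulr_ge0.
move/choice : a_cvg => [r ar].
exists (\poly_(k < K.+1) r k + (ln (G 0))%:P) => u.
rewrite hornerD hornerC; apply/eqP; rewrite -subr_eq -/(H u) -subr_eq0 -normr_le0 leNgt.
apply/negP; set d := `| _ - _|; move=> d0.
have arP : (\poly_(k < K.+1) a j k).[u] @[j --> U] --> (\poly_(k < K.+1) r k).[u].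
  under eq_cvg do rewrite horner_poly.
  rewrite horner_poly; apply: cvg_big => [|k _]; first exact: add_continuous.
  apply: cvgM; first exact: ar.
  exact: cvg_cst.
have key y : 0 < y -> `|u| <= y -> d <= (`|u| / y) ^+ K.+1 * H y.
  move=> y0 uy; apply: (@ler_cvg_to _ U PU _ (fun j => `|D j u - (\poly_(k < K.+1) a j k).[u]|)
    (fun j => (`|u| / y) ^+ K.+1 * D j y)).
  - by apply: cvg_norm; apply: cvgB.
  - by apply: cvgM => //; exact: cvg_cst.
  - apply: nearW => j.
    have := gen_fun_tail K (q0 j) (qg j) y0 uy.
    rewrite -(@ler_pM2l _ (j.*2.+1%:R))// mulrCA -/(D j y); apply: le_trans.
    rewrite -[X in X * _]ger0_norm// -normrM le_eqVlt.
    apply/orP; left; apply/eqP; congr (`| _ |).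
    rewrite /D mulrBr mulrBr -addrA; congr (_ + _); rewrite -opprD; congr (- _).
    rewrite horner_poly /series/= big_mkord !big_ord_recl/= mul0r add0r !expr0 mulr1 mulrDr.
    rewrite (gen_fun0 (qg j)) mulr_sumr; congr (_ + _).
    by apply: eq_bigr => k _; rewrite mulrA.
pose C' := `|C| + `|ln (G 0)|.
have C0 : 0 <= C' by rewrite addr_ge0.
pose M := `|u| ^+ K.+1 * C' * 2 ^+ K.
have M0 : 0 <= M by rewrite !mulr_ge0// exprn_ge0.
(* The bound below is M / y; this y makes it smaller than the distance d. *)
pose y := 1 + `|u| + M / d.
have Md : 0 <= M / d by rewrite divr_ge0// ltW.
have y1 : 1 <= y by rewrite /y -addrA lerDl addr_ge0.
have y0 : 0 < y by lra.
have uy : `|u| <= y by rewrite /y; lra.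
have := key y y0 uy; apply/negP; rewrite -ltNge.
have Hy : H y <= C' * (2 * y) ^+ K.
  apply: (@le_trans _ _ (C' * (1 + y) ^+ K)); last first.
    by rewrite ler_wpM2l// lerXn2r ?nnegrE; lra.
  rewrite /H /C' mulrDl lerD//.
    by rewrite (le_trans (GK y _)) ?ler_wpM2r ?ler_norm ?exprn_ge0//; lra.
  rewrite (@le_trans _ _ `|ln (G 0)|)//; first by rewrite -normrN ler_norm.
  by rewrite ler_peMr// exprn_ege1//; lra.
apply: (@le_lt_trans _ _ (M / y)).
  rewrite (le_trans (ler_wpM2l _ Hy)) ?exprn_ge0 ?divr_ge0 ?(ltW y0)//.
  rewrite /M !exprMn exprVn exprS [y ^+ K.+1]exprS invfM.
  have yK : y ^+ K != 0 by rewrite expf_neq0// gt_eqF.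
  by rewrite le_eqVlt; apply/orP; left; apply/eqP; field; rewrite yK gt_eqF.
rewrite ltr_pdivrMr// /y mulrDr [d * (M / d)]mulrC divfK ?gt_eqF//.
by rewrite ltrDr mulr_gt0// ltr_pwDl.
Qed.
End GeneratingFunction.

(** * Infinitely divisible laws on the natural numbers *)

Lemma coef_poly_exp (R : realType) (q : nat -> R) (n M m : nat) :
  ((\poly_(k < M) q k) ^+ n)`_m =
  \sum_(f : {ffun 'I_n -> 'I_M} | (\sum_i f i == m)%N) \prod_i q (f i).
Proof.
rewrite poly_def -{1}(card_ord n) -prodr_const.
rewrite (bigA_distr_bigA (fun (i : 'I_n) (k : 'I_M) => q k *: 'X^k)) coef_sum big_mkcond.
rewrite [RHS]big_mkcond; apply: eq_bigr => f _.
by rewrite scaler_prod prodrXr coefZ coefXn eq_sym; case: eqP; rewrite ?mulr1 ?mulr0.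
Qed.

Section Law.
Context {R : realType}.

Definition nats : set R := range (fun k : nat => k%:R).

Lemma measurable_nats : measurable nats.
Proof.
rewrite (_ : nats = \bigcup_k [set k%:R]); first exact: bigcupT_measurable.
by apply/seteqP; split => x; [move=> [k _ <-]; exists k|move=> [k _ ->]; exists k].
Qed.

Lemma measurable_neg : measurable [set x : R | x < 0].
Proof.
by rewrite (_ : [set x | _] = `]-oo, 0[%classic).
Qed.

Lemma measurable_nonneg : measurable [set x : R | 0 <= x].
Proof.
rewrite (_ : [set x | _] = `[0, +oo[%classic)//.
by apply/seteqP; split => x /=; rewrite in_itv/= andbT.
Qed.

(** Real-valued probabilities, on which field and order reasoning is available. *)
Definition pr {d} {T : measurableType d} (Q : probability T R) A := fine (Q A).

Section Pr.
Context {d : measure_display} {T : measurableType d} (Q : probability T R).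

Lemma prK A : measurable A -> (pr Q A)%:E = Q A.
Proof. by move=> mA; rewrite fineK// fin_num_measure. Qed.

Lemma pr_ge0 A : 0 <= pr Q A. Proof. exact/fine_ge0/measure_ge0. Qed.

Lemma le_pr A B : measurable A -> measurable B -> A `<=` B -> pr Q A <= pr Q B.
Proof. by move=> mA mB AB; rewrite -lee_fin !prK// le_measure ?inE. Qed.

Lemma pr_setC A : measurable A -> pr Q (~` A) = 1 - pr Q A.
Proof.
move=> mA; apply: EFin_inj; rewrite EFinB !prK//; last exact: measurableC.
exact: probability_setC.
Qed.

Lemma pr_setI1 A F : measurable A -> measurable F -> pr Q F = 1 ->
  pr Q (A `&` F) = pr Q A.
Proof.
move=> mA mF F1; apply: EFin_inj; rewrite !prK//; last exact: measurableI.
have mFC := measurableC mF.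
have FC0 : Q (~` F) = 0%E by rewrite -prK// pr_setC// F1 subrr.
rewrite -[in RHS](setIT A) -(setUv F) setIUr measureU//; last 3 first.
- exact: measurableI.
- exact: measurableI.
- by rewrite setIACA setICr setI0.
rewrite [X in _ = (_ + X)%E](_ : _ = 0%E) ?adde0//.
by apply/eqP; rewrite -measure_le0 -FC0 le_measure ?inE//; exact: measurableI.
Qed.

End Pr.
Section IID.
Context {d : measure_display} {T : measurableType d} {Q : probability T R}.
Context {n : nat} {Y : 'I_n -> {RV Q >-> R}}.
Context (indY : mutually_independent Q Y).
Context (idY : forall (i j : 'I_n) (B : set R), measurable B ->
  distribution Q (Y i) B = distribution Q (Y j) B).

Let measurable_inY i (B : set R) : measurable B -> measurable [set w | B (Y i w)].
Proof. by move=> mB; rewrite -[X in measurable X]setTI; exact: measurable_funP. Qed.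

Let measurable_allY (B : 'I_n -> set R) : (forall i, measurable (B i)) ->
  measurable [set w | forall i, B i (Y i w)].
Proof.
move=> mB; rewrite (_ : [set w | _] = \bigcap_(i in [set: 'I_n]) [set w | B i (Y i w)]).
  by apply: fin_bigcap_measurable => // i _; exact: measurable_inY.
by apply/seteqP; split => w /= h i; [move=> _|]; exact: h.
Qed.

Let measurable_sumY : measurable_fun setT (fun w => \sum_i Y i w).
Proof. by apply: measurable_sum => i; exact: measurable_funP. Qed.

Let measurable_insum (B : set R) : measurable B -> measurable [set w | B (\sum_i Y i w)].
Proof. by move=> mB; rewrite -[X in measurable X]setTI; exact: measurable_sumY. Qed.

Lemma pr_allY (B : 'I_n -> set R) : (forall i, measurable (B i)) ->
  pr Q [set w | forall i, B i (Y i w)] = \prod_i pr Q [set w | B i (Y i w)].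
Proof.
move=> mB; apply: EFin_inj; rewrite -prodEFin prK; last exact: measurable_allY.
by rewrite indY//; apply: eq_bigr => i _; rewrite prK//; exact: measurable_inY.
Qed.

Lemma pr_Y i j (B : set R) : measurable B ->
  pr Q [set w | B (Y i w)] = pr Q [set w | B (Y j w)].
Proof. by move=> mB; rewrite /pr -[X in fine X]/(distribution Q (Y i) B) (idY i j). Qed.

Lemma pr_allY1 (B : set R) : measurable B ->
  (forall i, pr Q [set w | B (Y i w)] = 1) -> pr Q [set w | forall i, B (Y i w)] = 1.
Proof. by move=> mB B1; rewrite (pr_allY (fun=> mB)) big1. Qed.

(** If all the summands are negative then so is the sum, and by independence
    this has for probability a power of the probability for one summand. *)
Lemma pr_summand_ge0 i :
  pr Q [set w | \sum_i Y i w < 0] = 0 -> pr Q [set w | 0 <= Y i w] = 1.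
Proof.
move=> Q0; pose N := [set x : R | x < 0].
have mN : measurable N by exact: measurable_neg.
rewrite (_ : [set w | _] = ~` [set w | N (Y i w)]); last first.
  by apply/seteqP; split => w /=; rewrite /N/= leNgt => /negP.
rewrite pr_setC; last exact: measurable_inY.
suff -> : pr Q [set w | N (Y i w)] = 0 by rewrite subr0.
have : pr Q [set w | forall j, N (Y j w)] = 0.
  apply/eqP; rewrite eq_le pr_ge0 andbT -Q0 le_pr//.
  - exact: (measurable_allY (fun=> mN)).
  - exact: (@measurable_insum N).
  - move=> w /= Yw; rewrite (bigD1 i)//=.
    have : \sum_(j | j != i) Y j w <= 0 by apply: sumr_le0 => j _; exact/ltW/Yw.
    by have := Yw i; rewrite /N/=; lra.
rewrite (pr_allY (fun=> mN)) (eq_bigr (fun=> pr Q [set w | N (Y i w)])); last first.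
  by move=> j _; exact: pr_Y.
by rewrite prodr_const => /eqP; rewrite expf_eq0 => /andP[_ /eqP].
Qed.

(** A sum of nonnegative terms vanishes only if they all do. *)
Lemma pr_sum0_le i : (forall i, pr Q [set w | 0 <= Y i w] = 1) ->
  pr Q [set w | \sum_i Y i w = 0] <= pr Q [set w | Y i w = 0] ^+ n.
Proof.
move=> Y0; pose N := [set x : R | 0 <= x].
have mN : measurable N by exact: measurable_nonneg.
have m1 : measurable [set 0 : R] by [].
have mall := measurable_allY (fun=> mN); have mall0 := measurable_allY (fun=> m1).
have msum := measurable_insum m1.
rewrite -(pr_setI1 msum mall (pr_allY1 mN Y0)).
apply: le_trans (le_pr Q _ mall0 _) _; first exact: measurableI.
  by move=> w [/= sw Yw] j; exact: (psumr_eq0P (fun j _ => Yw j) sw).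
rewrite (pr_allY (fun=> m1)) (eq_bigr (fun=> pr Q [set w | Y i w = 0])); last first.
  by move=> j _; exact: (pr_Y _ _ m1).
by rewrite prodr_const card_ord.
Qed.

(** With positive probability all the other summands vanish, and then the sum
    is the remaining summand. *)
Lemma pr_summand_nats i : pr Q [set w | nats (\sum_i Y i w)] = 1 ->
  (forall j, pr Q [set w | Y j w = 0] != 0) -> pr Q [set w | nats (Y i w)] = 1.
Proof.
move=> sumN Y0; have mN := measurable_nats.
pose B j := if j == i then ~` nats else [set 0 : R].
have mB j : measurable (B j) by rewrite /B; case: ifP => // _; exact: measurableC.
have : pr Q [set w | forall j, B j (Y j w)] = 0.
  apply/eqP; rewrite eq_le pr_ge0 andbT -(subrr 1) -{2}sumN -pr_setC; last first.
    exact: measurable_insum.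
  apply: le_pr; first exact: measurable_allY.
    by apply: measurableC; exact: measurable_insum.
  move=> w /= BY; have := BY i; rewrite /B eqxx; apply: contra_not.
  rewrite (bigD1 i)//= big1 ?addr0// => j ji.
  by have := BY j; rewrite /B (negbTE ji).
have prodn0 : \prod_(j | j != i) pr Q [set w | B j (Y j w)] != 0.
  by apply/prodf_neq0 => j ji; rewrite /B (negbTE ji); exact: Y0.
rewrite (pr_allY mB) (bigD1 i)//= => /eqP; rewrite mulf_eq0 (negbTE prodn0) orbF /B eqxx.
rewrite (_ : [set w | _] = ~` [set w | nats (Y i w)])// pr_setC; last exact: measurable_inY.
by rewrite subr_eq0 => /eqP.
Qed.

(** The coefficient of degree m of the n-th power of the truncated polynomial is
    the probability that the sum is m while every summand is a natural number
    below M. *)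
Lemma summand_conv_root i : (forall j, pr Q [set w | nats (Y j w)] = 1) ->
  conv_root (fun m => pr Q [set w | \sum_i Y i w = m%:R]) n
    (fun k => pr Q [set w | Y i w = k%:R]).
Proof.
move=> YN M m.
pose F (f : {ffun 'I_n -> 'I_M}) := [set w | forall j, [set (f j)%:R] (Y j w)].
have m1 (x : R) : measurable [set x] by [].
have mF f : measurable (F f) by exact: (measurable_allY (fun j => m1 (f j)%:R)).
pose D := [set f : {ffun 'I_n -> 'I_M} | (\sum_i f i == m)%N].
have mE : measurable (\bigcup_(f in D) F f).
  by apply: fin_bigcup_measurable => //; exact: finite_finset.
have msum := measurable_insum (m1 m%:R).
have coefE : ((\poly_(k < M) pr Q [set w | Y i w = k%:R]) ^+ n)`_m =
    pr Q (\bigcup_(f in D) F f).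
  rewrite coef_poly_exp; apply: EFin_inj; rewrite prK// measure_fin_bigcup//; first last.
  - move=> f g _ _ [w [Ff Fg]]; apply/ffunP => j; apply/val_inj.
    by apply/eqP; rewrite -(eqr_nat R); rewrite -(Ff j) -(Fg j).
  - exact: finite_finset.
  rewrite -sumEFin (bigfs _ (r := index_enum _))//; first last.
  - by move=> f _; rewrite mem_index_enum.
  - exact: index_enum_uniq.
  apply: eq_fsbigr => f _; apply/esym; apply: (etrans (esym (prK Q (mF f)))).
  rewrite (pr_allY (fun=> m1 _)); congr (_%:E).
  by apply: eq_bigr => j _; exact: (pr_Y j i (m1 _)).
rewrite coefE pr_ge0; split=> [|mM].
  apply: le_pr => // w [f /eqP fm] Ff /=.
  by rewrite -fm natr_sum; apply: eq_bigr => j _; exact: Ff.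
apply/eqP; rewrite eq_le; apply/andP; split.
  apply: le_pr => // w [f /eqP fm] Ff /=.
  by rewrite -fm natr_sum; apply: eq_bigr => j _; exact: Ff.
have mN := measurable_nats; have mall := measurable_allY (fun=> mN).
rewrite -(pr_setI1 msum mall (pr_allY1 mN YN)); apply: le_pr => //.
  exact: measurableI.
move=> w [/= sw YNw]; have kk j : exists k, Y j w = k%:R.
  by have [k _ <-] := YNw j; exists k.
move/choice : kk => [k Yk].
have km : (\sum_j k j)%N = m.
  apply/eqP; rewrite -(eqr_nat R) natr_sum -sw; apply/eqP.
  by apply: eq_bigr => j _; rewrite Yk.
have kM j : (k j < M)%N by apply: leq_ltn_trans mM; rewrite -km (bigD1 j)//= leq_addr.
exists [ffun j => Ordinal (kM j)] => [|j]; last by rewrite /= ffunE/= Yk.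
by rewrite /D/= -km; apply/eqP; apply: eq_bigr => j _; rewrite ffunE.
Qed.

End IID.

(** The summands of a decomposition are arbitrary real random variables.  That
    the sum is a natural number, and vanishes with positive probability,
    forces them to be natural numbers too. *)
Lemma infinitely_divisible_conv_root (mu : probability R R) :
  infinitely_divisible mu -> mu nats = 1%E -> mu [set 0] != 0%E ->
  forall n, (0 < n)%N ->
    exists q : nat -> R, (forall k, 0 <= q k) /\
    conv_root (fun m => pr mu [set m%:R]) n q.
Proof.
move=> idmu muN mu0 n n0.
have [d [T [Q [Y [indY idY muE]]]]] := idmu n n0.
have prE (B : set R) : measurable B -> pr mu B = pr Q [set w | B (\sum_i Y i w)].
  by move=> mB; rewrite /pr muE.
have mneg := measurable_neg.
have sN : pr Q [set w | nats (\sum_i Y i w)] = 1.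
  by rewrite -prE ?/pr ?muN//; exact: measurable_nats.
have sneg : pr Q [set w | \sum_i Y i w < 0] = 0.
  have N0 : pr mu (~` nats) = 0.
    by rewrite pr_setC ?/pr ?muN ?subrr//; exact: measurable_nats.
  rewrite -(prE _ mneg); apply/eqP; rewrite eq_le pr_ge0 andbT -[leRHS]N0.
  apply: le_pr => //; first by apply: measurableC; exact: measurable_nats.
  by move=> x /= x0 [k _ kx]; move: x0; rewrite -kx ltrn0.
have Y0 i := pr_summand_ge0 indY idY i sneg.
have Y0n i : pr Q [set w | Y i w = 0] != 0.
  apply/eqP => Yi0; move/negP : mu0; apply; apply/eqP.
  rewrite -prK// (prE [set 0])//; congr (_%:E); apply/eqP.
  by rewrite eq_le pr_ge0 andbT (le_trans (pr_sum0_le indY idY i Y0))// Yi0 expr0n gtn_eqF.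
exists (fun k => pr Q [set w | Y (Ordinal n0) w = k%:R]).
split=> [k|]; first exact: pr_ge0.
have YN i : pr Q [set w | nats (Y i w)] = 1 by exact: pr_summand_nats.
have h := summand_conv_root indY idY (Ordinal n0) YN.
have e : (fun m : nat => pr Q [set w | \sum_i Y i w = m%:R]) = fun m => pr mu [set m%:R].
  by apply/funext => m; apply/esym; exact: (prE [set m%:R]).
by rewrite e in h.
Qed.
End Law.

(** * The inverse of a stable subordinator *)

Section FirstPassage.
Context {R : realType} {d : measure_display} {T : measurableType d} (D : R -> T -> R) (t : R).
Context (D0 : forall w, D 0 w = 0).
Context (Dmono : forall w (r s : R), 0 <= r -> r <= s -> D r w <= D s w).
Context (t0 : 0 < t).

Let E := inverse_subordinator D t.

Lemma inverse_subordinator_ge0 w : 0 <= E w.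
Proof.
rewrite /E /inverse_subordinator; set S := [set s | _].
have [->|/set0P S0] := eqVneq S set0; first by rewrite inf0.
by apply: lb_le_inf => // x [/ltW].
Qed.

Lemma inverse_subordinator_le w (s : R) : 0 <= s -> t < D s w -> E w <= s.
Proof.
move=> s0 tD; apply: ge_inf; first by exists 0 => x [/ltW].
split=> //; rewrite lt_neqAle s0 andbT; apply/eqP => s00.
by move: tD; rewrite -s00 D0 ltNge ltW.
Qed.

(** Monotone paths allow restricting to rational times, which gives
    measurability.  The second alternative is the path that never passes t, to
    which the infimum of the empty set assigns the value 0. *)
Lemma inverse_subordinator_ltP w (r : R) : 0 < r ->
  E w < r <-> (exists q : rat, [/\ 0 < ratr q :> R, ratr q < r & t < D (ratr q) w]) \/
    (forall n : nat, D n%:R w <= t).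
Proof.
move=> r0; split=> [Er|[[q [q0 qr tD]]|Dn]].
- pose S := [set s | 0 < s /\ t < D s w].
  have [S0|/set0P S0] := eqVneq S set0.
    right=> n; rewrite leNgt; apply/negP => tD.
    have n0 : (0 < n)%N.
      by rewrite lt0n; apply/eqP => n0; move: tD; rewrite n0 D0 ltNge ltW.
    suff : S n%:R by rewrite S0.
    by split=> //; rewrite ltr0n.
  left; have [s [s0 tD] sr] := inf_lt S0 Er.
  have [q] := rat_in_itvoo sr; rewrite in_itv/= => /andP[sq qr].
  exists q; split=> //; first exact: lt_trans sq.
  by apply: (lt_le_trans tD); apply: Dmono; exact: ltW.
- by apply: le_lt_trans qr; apply: inverse_subordinator_le => //; exact: ltW.
- rewrite /E /inverse_subordinator (_ : [set s | _] = set0) ?inf0//.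
  apply/seteqP; split=> // s [s0]; apply/negP; rewrite -leNgt.
  apply: le_trans (Dn (Num.trunc s).+1); apply: Dmono; first exact: ltW.
  by apply/ltW; have /andP[] := truncn_itv (ltW s0).
Qed.

Lemma inverse_subordinator_eq0 w (s : R) n : E w = 0 -> 0 < s -> t < D s w \/ D n%:R w <= t.
Proof.
move=> Ew s0; have : E w < s by rewrite Ew.
move=> /(inverse_subordinator_ltP w s0)[[q [q0 qs tD]]|Dn]; last by right.
by left; apply: (lt_le_trans tD); apply: Dmono; exact: ltW.
Qed.

End FirstPassage.

Lemma markov_pr {R : realType} {d} {T : measurableType d} (P : probability T R)
    (f : T -> R) (A : set T) (c : R) :
  measurable_fun setT f -> (forall w, 0 <= f w) -> measurable A -> 0 <= c ->
  (forall w, A w -> c <= f w) ->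
  ((c * pr P A)%:E <= \int[P]_w (f w)%:E)%E.
Proof.
move=> mf f0 mA c0 cf; have mfE : measurable_fun setT (EFin \o f) by apply/measurable_EFinP.
apply: (@le_trans _ _ (\int[P]_(w in A) (f w)%:E)%E); last first.
  by apply: ge0_subset_integral => // w _; rewrite lee_fin.
rewrite EFinM prK// -integral_cst//; apply: ge0_le_integral => //.
- exact: measurable_funTS.
Qed.

Section StableInverse.
Context {R : realType} {d : measure_display} {T : measurableType d}.
Context {P : probability T R} {beta : R} {D : R -> {RV P >-> R}}.
Context (beta0 : 0 < beta).
Context (beta1 : beta < 1).
Context (stableD : stable_subordinator beta D).
Context {t : R}.
Context (t0 : 0 < t).

Let E := inverse_subordinator D t.

Let D0 w : D 0 w = 0. Proof. by case: stableD => -[[]]. Qed.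

Let Dmono w (r s : R) : 0 <= r -> r <= s -> D r w <= D s w.
Proof. by move=> r0 rs; case: stableD => -[_ h] _; exact: h. Qed.

Let laplaceD (u s : R) : 0 <= u -> 0 <= s ->
  (\int[P]_w (expR (- s * D u w))%:E = (expR (- u * s `^ beta))%:E)%E.
Proof. by move=> u0 s0; case: stableD => _ /(_ u s u0 s0); rewrite unlock. Qed.

Let measurable_Dgt (u : R) : measurable [set w | t < D u w].
Proof.
rewrite -[X in measurable X]setTI.
have -> : [set w | t < D u w] = D u @^-1` `]t, +oo[%classic.
  by apply/seteqP; split => w /=; rewrite in_itv/= andbT.
exact: measurable_funP.
Qed.

Let measurable_Dle (u : R) : measurable [set w | D u w <= t].
Proof.
rewrite (_ : [set w | _] = ~` [set w | t < D u w]); first exact: measurableC.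
by apply/seteqP; split => w /=; rewrite leNgt => /negP.
Qed.

Lemma measurable_inverse_subordinator : measurable_fun setT E.
Proof.
move=> mT; apply: (measurability _ (RGenInftyO.measurableE R)) => //.
move=> _ [_ [r ->] <-]; rewrite setTI.
have [r0|r0] := leP r 0.
  rewrite (_ : _ @^-1` _ = set0)//; apply/seteqP; split => // w /=.
  rewrite in_itv/= ltNge => /negP; apply; apply: (le_trans r0).
  exact: inverse_subordinator_ge0.
have -> : E @^-1` `]-oo, r[ =
    \bigcup_(q : rat) (if (0 < ratr q :> R) && (ratr q < r)
      then [set w | t < D (ratr q) w] else set0)
    `|` \bigcap_n [set w | D n%:R w <= t].
  apply/seteqP; split=> w; rewrite /= in_itv/=.
    move=> /(inverse_subordinator_ltP D0 Dmono t0 w r0)[[q [q0 qr tD]]|Dn]; last first.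
      by right=> n _; exact: Dn.
    by left; exists q => //; rewrite q0 qr.
  move=> h; apply/(inverse_subordinator_ltP D0 Dmono t0 w r0).
  case: h => [[q _]|Dn]; last by right=> n; exact: Dn.
  by case: ifPn => // /andP[q0 qr] tD; left; exists q.
apply: measurableU; last by apply: bigcapT_measurable => n; exact: measurable_Dle.
apply: countable_bigcupT_measurable => [|q]; first exact: countableP.
by case: ifP.
Qed.

Let measurable_expD (c u : R) : measurable_fun setT (fun w => expR (c * D u w)).
Proof.
by apply: measurableT_comp => //; apply: measurable_funM => //; exact: measurable_funP.
Qed.

(** If D u were almost surely at most t, then exp (- u s ^ beta), its Laplace
    transform at s, would be at least exp (- s t) for every s > 0.  As beta < 1,
    this fails for small s. *)
Lemma pr_stable_gt_gt0 (u : R) : 0 < u -> 0 < pr P [set w | t < D u w].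
Proof.
move=> u0; rewrite lt_neqAle pr_ge0 andbT eq_sym; apply/eqP => pr0.
have key (s : R) : 0 < s -> u * s `^ beta <= s * t.
  move=> s0; have DleP : pr P [set w | D u w <= t] = 1.
    rewrite (_ : [set w | _] = ~` [set w | t < D u w]); first by rewrite pr_setC// pr0 subr0.
    by apply/seteqP; split => w /=; rewrite leNgt => /negP.
  have : ((expR (- s * t) * pr P [set w | (D u w <= t)%R])%:E <=
      \int[P]_w (expR (- s * D u w))%:E)%E.
    by apply: markov_pr => // w /= Dt; rewrite ler_expR !mulNr lerN2 ler_pM2l.
  rewrite (laplaceD (ltW u0) (ltW s0)) DleP mulr1 lee_fin ler_expR !mulNr lerN2 //.
(* With this s, u * s ^ beta is twice s * t. *)
pose s := (u / (2 * t)) `^ (1 - beta)^-1.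
have ut0 : 0 < u / (2 * t) by rewrite divr_gt0// mulr_gt0.
have s0 : 0 < s by rewrite powR_gt0.
have sb : s `^ (1 - beta) = u / (2 * t).
  by rewrite /s -powRrM mulVf ?powRr1 ?(ltW ut0)// subr_eq0 gt_eqF.
have := key s s0.
rewrite [s in s * t](_ : s = s `^ beta * s `^ (1 - beta)); last first.
  rewrite -powRD ?(gt_eqF s0) ?implybT// (_ : beta + (1 - beta) = 1); last by lra.
  by rewrite powRr1// ltW.
rewrite sb [u * _]mulrC -mulrA ler_pM2l ?powR_gt0//.
have -> : u / (2 * t) * t = u / 2 by field; rewrite gt_eqF.
by lra.
Qed.

Lemma measurable_exp_inverse (c : R) : measurable_fun setT (fun w => expR (c * E w)).
Proof.
apply: measurableT_comp => //; apply: measurable_funM => //.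
exact: measurable_inverse_subordinator.
Qed.

Lemma laplace_inverse_ge (e y : R) : 0 < e -> 0 <= y ->
  ((expR (- y * e) * pr P [set w | (t < D e w)%R])%:E <= \int[P]_w (expR (- y * E w))%:E)%E.
Proof.
move=> e0 y0; apply: markov_pr => //; first exact: measurable_exp_inverse.
move=> w /= tD; rewrite ler_expR !mulNr lerN2 ler_wpM2l//.
by apply: (inverse_subordinator_le D0 t0) => //; exact: ltW.
Qed.

(** When E vanishes, the path is above t at time t / 2, or still at most t at time n.
    In both cases exp (- D (t / 2)) is at most
    exp (- t) + exp (t - D n), and taking expectations for n large shows
    exp (- t / 2) <= exp (- t). *)
Lemma inverse_subordinator_not_ae0 : ~ {ae P, forall w, E w = 0}.
Proof.
move=> E0.
have key n : expR (- (t / 2)) <= expR (- t) + expR (t - n%:R).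
  have : (\int[P]_w (expR (- 1 * D (t / 2) w))%:E <=
     \int[P]_w ((expR (- t))%:E + (expR t)%:E * (expR (- 1 * D n%:R w))%:E))%E.
    apply: ae_ge0_le_integral => //.
    - exact/measurable_EFinP.
    - by move=> w _; rewrite -EFinM -EFinD lee_fin addr_ge0// mulr_ge0.
    - by apply: emeasurable_funD => //; apply: measurable_funeM; exact/measurable_EFinP.
    - apply: filterS E0 => w Ew _; rewrite -EFinM -EFinD lee_fin -expRD.
      have t20 : 0 < t / 2 by rewrite divr_gt0.
      have [tD|Dn] := inverse_subordinator_eq0 D0 Dmono t0 n Ew t20.
      + apply: (@le_trans _ _ (expR (- t))); last by rewrite lerDl.
        by rewrite ler_expR mulN1r lerN2 ltW.
      + apply: (@le_trans _ _ 1).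
          by rewrite -[leRHS]expR0 ler_expR mulN1r oppr_le0 -(D0 w) Dmono// ltW.
        by rewrite ler_wpDl// -[leLHS]expR0 ler_expR mulN1r subr_ge0.
  rewrite ge0_integralD//; last first.
  - by apply: measurable_funeM; exact/measurable_EFinP.
  rewrite ge0_integralZl//; last by apply/measurable_EFinP.
  rewrite integral_cst//= probability_setT mule1 !laplaceD ?divr_ge0 ?(ltW t0)//.
  by rewrite powR1 !mulr1 -EFinM -EFinD lee_fin -expRD.
have : expR (- (t / 2)) <= expR (- t) + expR t * 0.
  apply: (@ler_cvg_to nat \oo _ _ (cst (expR (- (t / 2))))
    (fun n => expR (- t) + expR t * expR (- n%:R))).
  - exact: cvg_cst.
  - apply: cvgD; first exact: cvg_cst.
    by apply: cvgM; [exact: cvg_cst|exact: cvgn_expR].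
  - by apply: nearW => n; rewrite -expRD; exact: key.
by rewrite mulr0 addr0 ler_expR lerN2 leNgt ltr_pdivrMr// mulr_natr mulr2n ltrDl t0.
Qed.

(** If E lies between j + 1 and j + 2 then the path is still below t at time j,
    and the j-th term of the series dominates exp (v E) (a Chernoff bound). *)
Lemma exp_inverse_le (v s : R) w : 0 <= v -> 0 <= s ->
  ((expR (v * E w))%:E <= (expR (2 * v))%:E +
    \sum_(0 <= j <oo) (expR (v * j.+2%:R + s * t) * expR (- s * D j%:R w))%:E)%E.
Proof.
move=> v0 s0; set F := fun j => (expR (v * j.+2%:R + s * t) * expR (- s * D j%:R w))%:E.
have F0 j : (0 <= F j)%E by rewrite lee_fin mulr_ge0.
have Ew0 : 0 <= E w by exact: inverse_subordinator_ge0.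
have /andP[] := truncn_itv Ew0; case: (Num.trunc _) => [_ E1|j jE Ej].
  apply: (@le_trans _ _ (expR (2 * v))%:E); last by rewrite leeDl// nneseries_ge0.
  by rewrite lee_fin ler_expR mulrC ler_wpM2r//; lra.
apply: (@le_trans _ _ (F j)).
  have Dt : D j%:R w <= t.
    rewrite leNgt; apply/negP => tD.
    have : E w <= j%:R by exact: (inverse_subordinator_le D0 t0).
    by rewrite leNgt (lt_le_trans _ jE)// ltr_nat.
  rewrite lee_fin -expRD ler_expR -addrA -[leLHS]addr0 lerD//.
    by rewrite ler_wpM2l// ltW.
  by rewrite mulNr -mulrBr mulr_ge0// subr_ge0.
apply: (@le_trans _ _ (\sum_(0 <= j <oo) F j)%E); last by rewrite leeDr// lee_fin.
apply: (@le_trans _ _ (\sum_(0 <= i < j.+1) F i)%E).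
  by rewrite big_nat_recr//= leeDr// sume_ge0.
exact: nneseries_lim_ge.
Qed.

(** In the previous bound the choice s ^ beta = 1 + v turns the expectation of
    the series into a geometric series of ratio exp (- 1), with a factor
    exp (2 v + s t) where s = (1 + v) ^ (1 / beta). *)
Lemma mgf_inverse_le : exists (C : R) (K : nat), forall v, 0 <= v ->
  (\int[P]_w (expR (v * E w))%:E <= (expR (C * (1 + v) ^+ K))%:E)%E.
Proof.
pose r : R := expR (- 1); have r1 : r < 1 by rewrite -[ltRHS]expR0 ltr_expR; lra.
pose c := (1 - r)^-1; have c0 : 0 < c by rewrite invr_gt0 subr_gt0.
pose K := (Num.trunc (beta^-1)).+1.
have bK : beta^-1 <= K%:R.
  by apply/ltW; have /andP[] := @truncn_itv _ (beta^-1) ltac:(by rewrite invr_ge0 ltW).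
exists (2 + t + c), K => v v0; pose s := (1 + v) `^ beta^-1.
have s0 : 0 <= s by exact: powR_ge0.
have sb : s `^ beta = 1 + v by rewrite /s -powRrM mulVf ?gt_eqF// powRr1//; lra.
have sK : s <= (1 + v) ^+ K.
  by rewrite /s -powR_mulrn; [rewrite ler_powR//; lra|lra].
pose F j w := (expR (v * j.+2%:R + s * t) * expR (- s * D j%:R w))%:E.
have mF j : measurable_fun setT (F j).
  by apply/measurable_EFinP; apply: measurable_funM.
have F0 j w : (0 <= F j w)%E by rewrite lee_fin mulr_ge0.
have intF j : (\int[P]_w F j w = (expR (2 * v + s * t) * r ^+ j)%:E)%E.
  rewrite /F; under eq_integral do rewrite EFinM.
  rewrite ge0_integralZl//; last by apply/measurable_EFinP.
  rewrite laplaceD// -EFinM sb -expRD /r -expRM_natl -expRD; congr (expR _)%:E.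
  by rewrite -natr1 -natr1; ring.
apply: (@le_trans _ _ (\int[P]_w ((expR (2 * v))%:E + \sum_(0 <= j <oo) F j w))%E).
  apply: ge0_le_integral => //.
  - by apply/measurable_EFinP; exact: measurable_exp_inverse.
  - by apply: emeasurable_funD => //; exact: ge0_emeasurable_sum.
  - by move=> w _; exact: exp_inverse_le.
rewrite ge0_integralD//; last 2 first.
- by move=> w _; exact: nneseries_ge0.
- exact: ge0_emeasurable_sum.
rewrite integral_cst//= probability_setT mule1 integral_nneseries//.
under eq_eseriesr do rewrite intF.
set a := expR (2 * v + s * t).
have a1 : expR (2 * v) <= a by rewrite ler_expR lerDl mulr_ge0// ltW.
have Hs : (\sum_(0 <= j <oo) (a * r ^+ j)%:E <= (a * c)%:E)%E.
  apply: lime_le.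
    apply: is_cvg_nneseries => j _ _.
    by rewrite lee_fin mulr_ge0 ?expR_ge0 ?exprn_ge0 ?expR_ge0.
  apply: nearW => n; rewrite sumEFin lee_fin.
  have := @geometric_seriesE _ a r (negbT (lt_eqF r1)).
  move=> /(congr1 (fun f => f n)); rewrite /series/= => ->.
  by rewrite ler_wpM2r ?(ltW c0)// ler_piMr ?expR_ge0// lerBlDr lerDl exprn_ge0 ?expR_ge0.
apply: le_trans (leeD2l _ Hs) _; rewrite -EFinD lee_fin.
have h1 : 1 <= (1 + v) ^+ K by rewrite exprn_ege1//; lra.
apply: (@le_trans _ _ (a * (1 + c))); first by rewrite mulrDr mulr1 lerD2r.
apply: (@le_trans _ _ (a * expR c)); first by rewrite ler_wpM2l ?expR_ge0// expR_ge1Dx.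
rewrite /a -expRD ler_expR 2!(mulrDl _ _ (_ ^+ K)) lerD//; last by rewrite ler_peMr// ltW.
rewrite lerD//; last by rewrite mulrC ler_wpM2l// ltW.
rewrite ler_wpM2l//; apply: (@le_trans _ _ (1 + v)); first by rewrite lerDr.
by rewrite -[leLHS]expr1 ler_weXn2l//; lra.
Qed.

End StableInverse.

(** * A Poisson process at an independent random time *)

Lemma cvg_nats (R : realType) (u : nat -> R) (l : R) :
  (forall n, nats (u n)) -> u @ \oo --> l -> nats l /\ \forall n \near \oo, u n = l.
Proof.
move=> uN ul; have [N _ HN] : \forall n \near \oo, `|l - u n| < 1 / 2.
  by move/cvgrPdist_lt : ul; apply; rewrite divr_gt0.
have eqN n : (N <= n)%N -> u n = u N.
  move=> Nn; have := HN n Nn; have := HN N (leqnn N) => /=.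
  have [a _ <-] := uN n; have [b _ <-] := uN N => h1 h2.
  have : `|a%:R - b%:R : R| < 1.
    have -> : a%:R - b%:R = (l - b%:R) - (l - a%:R) :> R by ring.
    by apply: (le_lt_trans (ler_normB _ _)); lra.
  case: (ltngtP a b) => [ab|ba|->]//.
    by rewrite distrC ger0_norm ?subr_ge0 ?ler_nat ?(ltnW ab)// -natrB ?(ltnW ab)//
      ltrn1 ltnS leqn0 subn_eq0 leqNgt ab.
  by rewrite ger0_norm ?subr_ge0 ?ler_nat ?(ltnW ba)// -natrB ?(ltnW ba)//
      ltrn1 ltnS leqn0 subn_eq0 leqNgt ba.
have uNl : l = u N.
  by apply: (cvg_unique _ ul) => //; apply: cvg_near_cst; exists N => // n; exact: eqN.
by split; [rewrite uNl|exists N => // n Nn; rewrite uNl; exact: eqN].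
Qed.

Lemma trunc_eqP (R : realType) (x : R) (j : nat) : 0 <= x ->
  Num.trunc x = j <-> j%:R <= x < j.+1%:R.
Proof.
move=> x0; split=> [<-|/andP[jx xj]]; first exact: truncn_itv.
have /andP[tx xt] := truncn_itv x0; apply/eqP; rewrite eqn_leq.
by rewrite -ltnS -(ltr_nat R) (le_lt_trans tx xj)/= -ltnS -(ltr_nat R) (le_lt_trans jx xt).
Qed.

(** The Poisson probability mass function, extended by continuity to the rate 0,
    where [poisson_pmf] is constantly 1. *)
Definition poisson_weight {R : realType} (lambda y : R) (k : nat) : R :=
  exp_coeff (lambda * y) k * expR (- (lambda * y)).

Lemma series_exp_le (R : realType) (x : R) n : 0 <= x ->
  series (exp_coeff x) n <= expR x.
Proof.
move=> x0; rewrite /expR; apply: nondecreasing_cvgn_le; last exact: is_cvg_series_exp_coeff.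
by apply: nondecreasing_series => k _ _; exact: exp_coeff_ge0.
Qed.

Lemma poisson_weight_ge0 (R : realType) (lambda y : R) k :
  0 <= lambda * y -> 0 <= poisson_weight lambda y k.
Proof. by move=> ly; rewrite mulr_ge0 ?exp_coeff_ge0. Qed.

Lemma poisson_weight_le1 (R : realType) (lambda y : R) k :
  0 <= lambda * y -> poisson_weight lambda y k <= 1.
Proof.
move=> ly; rewrite /poisson_weight expRN ler_pdivrMr ?expR_gt0// mul1r.
apply: le_trans (series_exp_le k.+1 ly).
by rewrite /series/= big_nat_recr//= lerDr sumr_ge0// => i _; exact: exp_coeff_ge0.
Qed.

Lemma continuous_poisson_weight (R : realType) (lambda : R) k :
  continuous (poisson_weight lambda ^~ k).
Proof.
move=> y; apply: cvgM.
  apply: cvgM; last exact: cvg_cst.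
  apply: (@continuous_comp _ _ _ (fun y => lambda * y) (fun x => x ^+ k)).
    by apply: cvgM; [exact: cvg_cst|exact: cvg_id].
  exact: exprn_continuous.
apply: continuous_cvg; first exact: continuous_expR.
by apply: cvgN; apply: cvgM; [exact: cvg_cst|exact: cvg_id].
Qed.

Section Subordination.
Context {R : realType} {d : measure_display} {T : measurableType d}.
Context {P : probability T R} {lambda : R} {N : R -> {RV P >-> R}} {W : T -> R}.
Context (lambda0 : 0 < lambda).
Context (poissonN : poisson_process lambda N).
Context (W0 : forall w, 0 <= W w).
Context (mW : measurable_fun setT W).
Context (indNW : forall (s : R) (A B : set R), 0 <= s -> measurable A -> measurable B ->
  P ([set w | A (N s w)] `&` [set w | B (W w)]) =
  (P [set w | A (N s w)] * P [set w | B (W w)])%E).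

(* The random time W is approximated from above by times Wn n taking countably
   many values, at which the process N can be evaluated by independence. *)
Let grid n j : R := j.+1%:R / n.+1%:R.
Let cell n j := [set w | Num.trunc (n.+1%:R * W w) = j].
Let Wn n w := grid n (Num.trunc (n.+1%:R * W w)).

Let n1 n : 0 < n.+1%:R :> R. Proof. by rewrite ltr0n. Qed.
Let nW0 n w : 0 <= n.+1%:R * W w. Proof. by rewrite mulr_ge0. Qed.

Let Wn_gt n w : W w < Wn n w.
Proof. by rewrite /Wn /grid ltr_pdivlMr// mulrC; have /andP[] := truncn_itv (nW0 n w). Qed.

Let Wn_le n w : Wn n w <= W w + n.+1%:R^-1.
Proof.
rewrite /Wn /grid ler_pdivrMr// mulrDl mulVf ?gt_eqF// -natr1 lerD2r [leRHS]mulrC.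
by have /andP[] := truncn_itv (nW0 n w).
Qed.

Let Wn_cvg w : Wn n w @[n --> \oo] --> W w.
Proof.
apply: (@squeeze_cvgr _ \oo _ _ (cst (W w)) (fun n => W w + n.+1%:R^-1)).
- by apply: nearW => n; rewrite /= (ltW (Wn_gt n w)) Wn_le.
- exact: cvg_cst.
- by rewrite -[X in _ --> X]addr0; apply: cvgD; [exact: cvg_cst|exact: cvg_harmonic].
Qed.

Let cellE n j : cell n j = [set w | `[j%:R / n.+1%:R, j.+1%:R / n.+1%:R[%classic (W w)].
Proof.
apply/seteqP; split=> w; rewrite /cell/= in_itv/=.
  by move=> /(trunc_eqP j (nW0 n w)); rewrite ler_pdivrMr// ltr_pdivlMr// mulrC.
by rewrite ler_pdivrMr// ltr_pdivlMr// mulrC => /(trunc_eqP j (nW0 n w)).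
Qed.

Let measurable_cell n j : measurable (cell n j).
Proof. by rewrite cellE -[X in measurable X]setTI; exact: mW. Qed.

Let trivIset_cell n : trivIset setT (cell n).
Proof.
apply/trivIsetP => i j _ _ ij; apply/seteqP; split => // w [].
by rewrite /cell/= => ci cj; move: ij; rewrite -ci -cj eqxx.
Qed.

Let bigcup_cell n : \bigcup_j cell n j = setT.
Proof. by apply/seteqP; split => // w _; exists (Num.trunc (n.+1%:R * W w)). Qed.

Let measurable_N s (A : set R) : measurable A -> measurable [set w | A (N s w)].
Proof. by move=> mA; rewrite -[X in measurable X]setTI; exact: measurable_funP. Qed.

Let Zn n w := N (Wn n w) w.

Let Zn_cell n (A : set R) :
  [set w | A (Zn n w)] = \bigcup_j ([set w | A (N (grid n j) w)] `&` cell n j).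
Proof.
apply/seteqP; split=> w /=; last by move=> [j _ [/= Aw cw]]; rewrite /Zn /Wn cw.
by move=> Aw; exists (Num.trunc (n.+1%:R * W w)).
Qed.

Let measurable_Zn n : measurable_fun setT (Zn n).
Proof.
move=> _ A mA; rewrite setTI (_ : _ @^-1` _ = [set w | A (Zn n w)])// Zn_cell.
by apply: bigcupT_measurable => j; apply: measurableI => //; exact: measurable_N.
Qed.

Let Zn_cvg w : Zn n w @[n --> \oo] --> N (W w) w.
Proof.
have [[_ _ _ /(_ w)[rc _]] _] := poissonN.
by apply: (cvg_at_rightP _ _ _).1 (rc _ (W0 w)) _ _.
Qed.

(** Right-continuity of the paths of N recovers N at W from the approximations
    taken strictly after W. *)
Lemma measurable_subordinated : measurable_fun setT (fun w => N (W w) w).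
Proof. by apply: measurable_fun_cvg => [n|w _]; [exact: measurable_Zn|exact: Zn_cvg]. Qed.

Lemma poisson_pmf_weight (s : R) k : 0 < s ->
  P [set w | N s w = k%:R] = (poisson_weight lambda s k)%:E.
Proof.
move=> s0; have [_ ->//] := poissonN.
by rewrite /poisson_pmf /poisson_weight /exp_coeff mulr_gt0.
Qed.

Lemma ae_poisson_nats (s : R) : 0 < s -> {ae P, forall w, nats (N s w)}.
Proof.
move=> s0.
have mNs := measurable_N s measurable_nats.
have Pn : P [set w | nats (N s w)] = 1%E.
  rewrite (_ : [set w | _] = \bigcup_k [set w | N s w = k%:R]); last first.
    by apply/seteqP; split => w [k _ /= kN]; exists k.
  rewrite measure_bigcup; last 2 first.
  - by move=> k _; exact: (measurable_N s (measurable_set1 _)).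
  - apply/trivIsetP => i j _ _ /eqP ij; apply/seteqP; split => // w [/= -> /eqP].
    by rewrite eqr_nat => /eqP.
  transitivity (poisson_prob (lambda * s) 0%N setT); last first.
    exact: (@probability_setT _ _ R (poisson_prob (lambda * s) 0%N)).
  rewrite /poisson_prob mulr_gt0// nneseries_esum; last by move=> k _; rewrite measure_ge0.
  rewrite (_ : [set x | _] = setT); last by apply/seteqP; split => // k _ /=; rewrite inE.
  by apply: eq_esum => k _; exact: (poissonN.2 s k s0).
exists (~` [set w | nats (N s w)]); split; first exact: measurableC.
  by rewrite probability_setC// Pn subee.
by move=> w.
Qed.

Let ae_Zn_nats : {ae P, forall w, forall n, nats (Zn n w)}.
Proof.
have : {ae P, forall w, forall n j, nats (N (grid n j) w)}.
  apply: ae_foralln => n; apply: ae_foralln => j; apply: ae_poisson_nats.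
  by rewrite divr_gt0.
by apply: filterS => w Nw n; exact: Nw.
Qed.

(** Almost surely, N is a natural number at all the countably many grid times,
    and a limit of natural numbers is a natural number. *)
Lemma ae_subordinated_nats : {ae P, forall w, nats (N (W w) w)}.
Proof. by apply: filterS ae_Zn_nats => w Zw; have [] := cvg_nats Zw (@Zn_cvg w). Qed.

Let measurable_Wn n : measurable_fun setT (Wn n).
Proof.
move=> _ A mA; rewrite setTI.
rewrite (_ : _ @^-1` _ = \bigcup_j (if grid n j \in A then cell n j else set0)); last first.
  apply/seteqP; split=> w /=.
    by move=> Aw; exists (Num.trunc (n.+1%:R * W w)) => //; rewrite mem_set.
  by move=> [j _]; case: ifPn => // /set_mem Aj cw; rewrite /Wn cw.
by apply: bigcupT_measurable => j; case: ifP.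
Qed.

Let measurable_weight k (f : T -> R) : measurable_fun setT f ->
  measurable_fun setT (fun w => (poisson_weight lambda (f w) k)%:E).
Proof.
move=> mf; apply/measurable_EFinP.
apply: (@measurableT_comp _ _ _ _ _ _ (poisson_weight lambda ^~ k) _ f) => //.
by apply: continuous_measurable_fun => y; exact: continuous_poisson_weight.
Qed.

Let Zn_law n k : P [set w | Zn n w = k%:R] =
  (\int[P]_w (poisson_weight lambda (Wn n w) k)%:E)%E.
Proof.
have lW w : 0 <= lambda * Wn n w.
  by rewrite mulr_ge0 ?(ltW lambda0)// (le_trans (W0 w))// ltW.
rewrite -(bigcup_cell n) ge0_integral_bigcup//; last 2 first.
- by rewrite bigcup_cell; apply: measurable_weight.
- by move=> w _; rewrite lee_fin poisson_weight_ge0.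
rewrite (Zn_cell n [set k%:R]) measure_bigcup; last 2 first.
- move=> j _; apply: measurableI => //.
  exact: (measurable_N (grid n j) (measurable_set1 k%:R)).
- apply/trivIsetP => i j _ _ ij; apply/seteqP; split => // w [[_ ci] [_ cj]].
  by move: ij; rewrite -(ci : _ = i) -(cj : _ = j) eqxx.
rewrite eseries_mkcond; apply: eq_eseriesr => j _; rewrite in_setT.
transitivity ((poisson_weight lambda (grid n j) k)%:E * P (cell n j))%E.
  rewrite -poisson_pmf_weight ?divr_gt0// cellE; apply: indNW => //.
  by rewrite divr_ge0.
rewrite -integral_cst//; apply: eq_integral => w; rewrite inE => cw.
by rewrite /Wn cw.
Qed.

(** Dominated convergence on both sides of the formula for the approximations.
    On the left, the approximations are eventually equal to their limit because
    they are natural numbers. *)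
Lemma subordinated_law k : P [set w | N (W w) w = k%:R] =
  (\int[P]_w (poisson_weight lambda (W w) k)%:E)%E.
Proof.
have lW n w : 0 <= lambda * Wn n w.
  by rewrite mulr_ge0 ?(ltW lambda0)// (le_trans (W0 w))// ltW.
have i1 : P.-integrable setT (cst 1%E).
  apply/integrableP; split => //.
  by rewrite integral_cst//= normr1 probability_setT mule1 ltry.
have lim1 : (\int[P]_w (poisson_weight lambda (Wn n w) k)%:E)%E @[n --> \oo] -->
    (\int[P]_w (poisson_weight lambda (W w) k)%:E)%E.
  apply: (@dominated_cvg _ _ _ P setT _ _ _ (cst 1%E)) => //.
  - by move=> n; exact: measurable_weight.
  - move=> w _; apply: cvg_EFin; first exact: nearW.
    apply: (@continuous_cvg _ _ _ _ _ (Wn^~ w) (poisson_weight lambda ^~ k) (W w)).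
      exact: continuous_poisson_weight.
    exact: Wn_cvg.
  - by move=> n w _; rewrite /= lee_fin ger0_norm ?poisson_weight_ge0// poisson_weight_le1.
pose I (Z : T -> R) w := (\1_[set w | Z w = k%:R] w)%:E : \bar R.
have mI (Z : T -> R) : measurable_fun setT Z -> measurable [set w | Z w = k%:R].
  by move=> mZ; rewrite -[X in measurable X]setTI; exact: (mZ _ _ (measurable_set1 k%:R)).
have intI (Z : T -> R) : measurable_fun setT Z -> (\int[P]_w I Z w = P [set w | Z w = k%:R])%E.
  by move=> mZ; rewrite integral_indic ?setIT//; exact: mI.
have mZ := measurable_subordinated.
have [|||//||_ _] := @dominated_convergence _ _ _ P setT measurableT
  (fun n => I (Zn n)) (I (fun w => N (W w) w)) (cst 1%E).
- by move=> n; apply/measurable_EFinP/measurable_indic; exact: mI.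
- by apply/measurable_EFinP/measurable_indic; exact: mI.
- apply: filterS ae_Zn_nats => w Zw _.
  have [_ ZN] := cvg_nats Zw (@Zn_cvg w).
  apply: cvg_near_cst; apply: filterS ZN => n e; rewrite /I !indicE.
  congr (_%:R%:E); congr nat_of_bool.
  by apply/idP/idP => /set_mem/= h; apply/mem_set => /=; [rewrite -e|rewrite e].
- apply: nearW => w n _; rewrite /I/= lee_fin indicE.
  by case: (_ \in _); rewrite ?normr1 ?normr0.
rewrite intI// => lim2; apply: (cvg_unique _ lim2) => //.
apply: cvg_trans lim1; apply: near_eq_cvg; apply: nearW => n /=.
by rewrite -Zn_law -intI.
Qed.

End Subordination.

(** * Mixed Poisson generating functions *)

Lemma normr_series_exp_le (R : realType) (x : R) n :
  `|series (exp_coeff x) n| <= expR `|x|.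
Proof.
apply: le_trans (series_exp_le n (normr_ge0 x)); apply: (le_trans (ler_norm_sum _ _ _)).
by apply: ler_sum => i _; rewrite /exp_coeff/= normrM normrX normfV (@ger0_norm _ i`!%:R).
Qed.

Definition mgf {R : realType} {d} {T : measurableType d} (P : probability T R)
    (W : T -> R) (v : R) : R :=
  fine (\int[P]_w (expR (v * W w))%:E)%E.

Section MixedPoisson.
Context {R : realType} {d : measure_display} {T : measurableType d}.
Context {P : probability T R} {lambda : R} {W : T -> R}.
Context (lambda0 : 0 < lambda).
Context (W0 : forall w, 0 <= W w).
Context (mW : measurable_fun setT W).
Context (mgfW : forall v, 0 <= v -> (\int[P]_w (expR (v * W w))%:E < +oo)%E).

Let mexp v : measurable_fun setT (fun w => (expR (v * W w))%:E).
Proof. by apply/measurable_EFinP; apply: measurableT_comp => //; exact: measurable_funM. Qed.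

Lemma mgf_integrable v : P.-integrable setT (fun w => (expR (v * W w))%:E).
Proof.
apply/integrableP; split; first exact: mexp.
under eq_integral do rewrite /= ger0_norm ?expR_ge0//.
apply: le_lt_trans (mgfW (normr_ge0 v)); apply: ge0_le_integral => //.
by move=> w _; rewrite lee_fin ler_expR ler_wpM2r// ler_norm.
Qed.

Lemma mgfE v : (mgf P W v)%:E = (\int[P]_w (expR (v * W w))%:E)%E.
Proof. by rewrite fineK//; apply: integrable_fin_num => //; exact: mgf_integrable. Qed.

Lemma le_mgf (u v : R) : u <= v -> mgf P W u <= mgf P W v.
Proof.
move=> uv; rewrite -lee_fin !mgfE; apply: ge0_le_integral => //.
by move=> w _; rewrite lee_fin ler_expR ler_wpM2r.
Qed.

(** The exponential series of lambda u W can be integrated termwise, as its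
    partial sums are dominated by exp (lambda |u| W), up to the factor
    exp (- lambda W) common to all the weights. *)
Lemma mixed_poisson_gen_fun (p : nat -> R) :
  (forall m, (p m)%:E = (\int[P]_w (poisson_weight lambda (W w) m)%:E)%E) ->
  gen_fun p (fun u => mgf P W (lambda * (u - 1))).
Proof.
move=> pE u; pose h n w := series (exp_coeff (lambda * u * W w)) n * expR (- lambda * W w).
have hE n w : h n w = \sum_(0 <= m < n) poisson_weight lambda (W w) m * u ^+ m.
  rewrite /h /series/= mulr_suml; apply: eq_bigr => m _.
  by rewrite /poisson_weight /exp_coeff/= !exprMn mulNr; ring.
have iw m : P.-integrable setT (fun w => (poisson_weight lambda (W w) m)%:E).
  have mpw : measurable_fun setT (fun w => poisson_weight lambda (W w) m).
    apply: (@measurableT_comp _ _ _ _ _ _ (poisson_weight lambda ^~ m) _ W) => //.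
    by apply: continuous_measurable_fun => y; exact: continuous_poisson_weight.
  apply: (@le_integrable _ _ _ P _ _ _ (fun w => (expR (0 * W w))%:E)) => //.
  - exact/measurable_EFinP.
  - move=> w _; have lW : 0 <= lambda * W w by rewrite mulr_ge0// ltW.
    rewrite mul0r expR0 !lee_fin normr1 ger0_norm ?poisson_weight_le1//.
    exact: poisson_weight_ge0.
  - exact: mgf_integrable.
have ih n : P.-integrable setT (fun w => (h n w)%:E).
  rewrite (_ : (fun w => _) = fun w => (\sum_(0 <= m < n)
      ((poisson_weight lambda (W w) m)%:E * (u ^+ m)%:E))%E).
    by apply: integrable_sum => // m _; exact: integrableZr.
  by apply/funext => w; rewrite hE -sumEFin.
have inth n : (\int[P]_w (h n w)%:E = (series (fun m => p m * u ^+ m) n)%:E)%E.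
  under eq_integral do rewrite hE -sumEFin.
  rewrite integral_sum//; last by move=> m; under eq_fun do rewrite EFinM; exact: integrableZr.
  rewrite /series/= -sumEFin; apply: eq_bigr => m _; under eq_integral do rewrite EFinM.
  by rewrite integralZr// -pE.
have : (\int[P]_w (h n w)%:E)%E @[n --> \oo] --> (mgf P W (lambda * (u - 1)))%:E.
  rewrite mgfE; apply: (@dominated_cvg _ _ _ P setT _ _ _
    (fun w => (expR (lambda * (`|u| - 1) * W w))%:E)) => //.
  - by move=> n; have /integrableP[] := ih n.
  - move=> w _; apply: cvg_EFin; first exact: nearW.
    rewrite (_ : expR _ = expR (lambda * u * W w) * expR (- lambda * W w)); last first.
      by rewrite -expRD; congr expR; ring.
    by apply: cvgM; [exact: is_cvg_series_exp_coeff|exact: cvg_cst].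
  - exact: mgf_integrable.
  - move=> n w _; rewrite lee_fin normrM (ger0_norm (expR_ge0 _)).
    apply: (le_trans (ler_wpM2r _ (normr_series_exp_le _ _))); first exact: expR_ge0.
    rewrite -expRD ler_expR !normrM (ger0_norm (ltW lambda0)) (ger0_norm (W0 w)).
    by rewrite le_eqVlt; apply/orP; left; apply/eqP; ring.
move=> /fine_cvg; apply: cvg_trans; apply: near_eq_cvg; apply: nearW => n /=.
by rewrite inth.
Qed.

End MixedPoisson.

(** * The Laplace transform of the inverse and the conclusion *)

Section Laplace.
Context {R : realType} {d : measure_display} {T : measurableType d}.
Context {P : probability T R} {beta t : R} {D : R -> {RV P >-> R}}.
Context (beta0 : 0 < beta).
Context (beta1 : beta < 1).
Context (stableD : stable_subordinator beta D).
Context (t0 : 0 < t).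

Let E := inverse_subordinator D t.
Let E0 w : 0 <= E w. Proof. exact: inverse_subordinator_ge0. Qed.
Let mE : measurable_fun setT E.
Proof. exact: (measurable_inverse_subordinator stableD t0). Qed.

Lemma mgf_inverse_lty v : 0 <= v -> (\int[P]_w (expR (v * E w))%:E < +oo)%E.
Proof.
have [C [K h]] := mgf_inverse_le beta0 stableD t0.
by move=> /h; move=> /le_lt_trans; apply; exact: ltry.
Qed.

Let mgfEE v : (mgf P E v)%:E = (\int[P]_w (expR (v * E w))%:E)%E.
Proof. exact: (mgfE E0 mE mgf_inverse_lty). Qed.

Lemma mgf_inverse_gt0 v : 0 < mgf P E v.
Proof.
have [v0|v0] := leP 0 v.
  apply: (@lt_le_trans _ _ 1) => //; rewrite -lee_fin mgfEE.
  have -> : 1%:E = (\int[P]_w (cst 1%:E) w)%E.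
    by rewrite integral_cst//= probability_setT mule1.
  apply: ge0_le_integral => //.
  - by apply/measurable_EFinP; apply: measurableT_comp => //; exact: measurable_funM.
  - by move=> w _; rewrite lee_fin -[leLHS]expR0 ler_expR mulr_ge0.
have v0' : 0 <= - v by rewrite oppr_ge0 ltW.
have := laplace_inverse_ge stableD t0 ltr01 v0'; rewrite !opprK -mgfEE lee_fin.
by apply: lt_le_trans; rewrite mulr_gt0 ?expR_gt0// (pr_stable_gt_gt0 beta1 stableD).
Qed.

Lemma mgf_inverse_le1 v : v <= 0 -> mgf P E v <= 1.
Proof.
move=> v0; rewrite -lee_fin mgfEE.
have -> : 1%:E = (\int[P]_w (cst 1%:E) w)%E.
    by rewrite integral_cst//= probability_setT mule1.
apply: ge0_le_integral => //.
- by apply/measurable_EFinP; apply: measurableT_comp => //; exact: measurable_funM.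
- by move=> w _; rewrite lee_fin -[leRHS]expR0 ler_expR mulr_le0_ge0.
Qed.

(** A polynomial r would satisfy - r >= 0, and - r <= e y + C for every e > 0 as
    E is at most e with positive probability.  So r is constant, equal to its
    value 0 at 0, and the mean of 1 - exp (- E) is 0. *)
Lemma mgf_inverse_not_exp_poly :
  ~ exists r : {poly R}, forall y, 0 <= y -> ln (mgf P E (- y)) = r.[y].
Proof.
move=> [r rE].
have sr : (size (- r) <= 1)%N.
  apply: sublinear_poly_const => [y y0|e e0].
    by rewrite hornerN -rE// oppr_ge0 ln_le0// mgf_inverse_le1// oppr_le0.
  pose c := pr P [set w | t < D e w].
  have c0 : 0 < c by exact: (pr_stable_gt_gt0 beta1 stableD).
  exists (- ln c) => y y0; rewrite hornerN -rE// lerNl opprD opprK.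
  have := laplace_inverse_ge stableD t0 e0 y0; rewrite -mgfEE lee_fin -/c => h.
  have -> : ln c - e * y = ln (expR (- y * e) * c).
    by rewrite lnM ?posrE ?expR_gt0// expRK; ring.
  by rewrite ler_ln// ?posrE ?mulr_gt0 ?expR_gt0// mgf_inverse_gt0.
have mgf1 : mgf P E (- 1) = 1.
  have := size1_polyC sr => rc.
  have r01 : r.[1] = r.[0] by rewrite -(opprK r) rc -polyCN !hornerC.
  have mgf0 : mgf P E (- 0) = 1.
    rewrite /mgf; under eq_integral do rewrite oppr0 mul0r expR0.
    by rewrite integral_cst//= probability_setT mule1.
  move: r01; rewrite -!rE// mgf0 ln1 => h.
  by rewrite -[LHS]lnK ?posrE ?mgf_inverse_gt0// h expR0.
have f0 w : 0 <= 1 - expR (- 1 * E w).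
  by rewrite subr_ge0 -[leRHS]expR0 ler_expR mulN1r oppr_le0.
have mf : measurable_fun setT (fun w => 1 - expR (- 1 * E w)).
  by apply: measurable_funB => //; apply: measurableT_comp => //; exact: measurable_funM.
have mfE : measurable_fun setT (fun w => (1 - expR (- 1 * E w))%:E) by exact/measurable_EFinP.
have mexpE : measurable_fun setT (fun w => (expR (- 1 * E w))%:E).
  by apply/measurable_EFinP; apply: measurableT_comp => //; exact: measurable_funM.
have intf0 : (\int[P]_w (1 - expR (- 1 * E w))%:E = 0)%E.
  have : (\int[P]_w ((1 - expR (- 1 * E w))%:E + (expR (- 1 * E w))%:E) = 1)%E.
    under eq_integral do rewrite -EFinD subrK.
    by rewrite integral_cst//= probability_setT mule1.
  rewrite ge0_integralD//; last by move=> w _; rewrite lee_fin.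
  by rewrite -mgfEE mgf1 => /(congr1 (fun x => x - 1)%E); rewrite addeK// subee.
apply: (inverse_subordinator_not_ae0 stableD t0).
have /(ae_eq_integral_abs P measurableT mfE) : (\int[P]_w `|(1 - expR (- 1 * E w))%:E| = 0)%E.
  by rewrite -[RHS]intf0; apply: eq_integral => w _; rewrite gee0_abs// lee_fin.
apply: filterS => w /(_ I) /= [] /eqP; rewrite subr_eq0 eq_sym => /eqP e1.
by apply/eqP; rewrite -oppr_eq0 -mulN1r; apply/eqP; apply: expR_inj; rewrite e1 expR0.
Qed.

End Laplace.

Lemma forall_ord1_set (T : Type) (Q : T -> Prop) :
  [set w | forall i : 'I_1, Q w] = [set w | Q w].
Proof. by apply/seteqP; split => w /= q => [|_]; [exact: (q ord0)|exact: q]. Qed.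

Theorem theorem3p1 (R : realType) (beta lambda : R)
    (d : measure_display) (T : measurableType d) (P : probability T R)
    (X : R -> {RV P >-> R}) :
  0 < beta -> beta < 1 -> 0 < lambda ->
  fractional_poisson_process beta lambda X ->
  forall t : R, 0 < t -> ~ infinitely_divisible (distribution P (X t)).
Proof.
move=> beta0 beta1 lambda0 [d' [T' [P' [D [N [stableD poissonN indND fdd]]]]]] t t0 idX.
pose W := inverse_subordinator D t.
have W0 w : 0 <= W w by exact: inverse_subordinator_ge0.
have mW : measurable_fun setT W by exact: (measurable_inverse_subordinator stableD t0).
have indNW (s : R) (A B : set R) : 0 <= s -> measurable A -> measurable B ->
    P' ([set w | A (N s w)] `&` [set w | B (W w)]) =
    (P' [set w | A (N s w)] * P' [set w | B (W w)])%E.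
  move=> s0 mA mB.
  by have := indND 1 1 (fun=> s) (fun=> t) (fun=> A) (fun=> B) (fun=> s0)
    (fun=> ltW t0) (fun=> mA) (fun=> mB); rewrite !forall_ord1_set.
set mu : probability R R := distribution P (X t).
have muE (B : set R) : measurable B -> mu B = P' [set w | B (N (W w) w)].
  move=> mB; have := fdd 1 (fun=> t) (fun=> B) (fun=> ltW t0) (fun=> mB).
  by rewrite !forall_ord1_set.
have muN : mu nats = 1%E.
  have mZ := measurable_subordinated poissonN W0 mW.
  have mZN : measurable [set w | nats (N (W w) w)].
    by rewrite -[X in measurable X]setTI; exact: (mZ _ _ measurable_nats).
  rewrite muE; last exact: measurable_nats.
  have N0 : P' (~` [set w | nats (N (W w) w)]) = 0%E.
    apply: measure_negligible; first exact: measurableC.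
    exact: (ae_subordinated_nats lambda0 poissonN W0).
  rewrite -prK//; congr (_%:E); apply/eqP; rewrite eq_sym -subr_eq0 -pr_setC//.
  by rewrite /pr N0.
have pE m : (pr mu [set m%:R])%:E = (\int[P']_w (poisson_weight lambda (W w) m)%:E)%E.
  rewrite prK// muE//; exact: (subordinated_law lambda0 poissonN W0 mW indNW m).
pose G u := mgf P' W (lambda * (u - 1)).
have G0 u : 0 < G u by exact: (mgf_inverse_gt0 beta0 beta1 stableD t0).
have pG : gen_fun (fun m => pr mu [set m%:R]) G.
  exact: (mixed_poisson_gen_fun lambda0 W0 mW (mgf_inverse_lty beta0 stableD t0) pE).
have mu0 : mu [set 0] != 0%E.
  have p0G : pr mu [set 0%:R] = G 0 by rewrite (gen_fun0 pG).
  by rewrite -prK// eqe p0G gt_eqF.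
have [C [K mgfK]] := mgf_inverse_le beta0 stableD t0.
have GK y : 0 <= y -> ln (G y) <= (`|C| * (1 + lambda) ^+ K) * (1 + y) ^+ K.
  move=> y0; apply: (@le_trans _ _ (C * (1 + lambda * y) ^+ K)); last first.
    apply: (@le_trans _ _ (`|C| * (1 + lambda * y) ^+ K)).
      by rewrite ler_wpM2r ?ler_norm// exprn_ge0// addr_ge0// mulr_ge0// ltW.
    by rewrite -mulrA -exprMn ler_wpM2l// lerXn2r ?nnegrE; nra.
  rewrite -[leRHS]expRK ler_ln ?posrE ?expR_gt0//.
  have ly : 0 <= lambda * y by rewrite mulr_ge0// ltW.
  have mgfW := mgf_inverse_lty beta0 stableD t0.
  rewrite -lee_fin; apply: le_trans (mgfK _ ly); rewrite -(mgfE W0 mW mgfW) lee_fin.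
  by apply: (le_mgf W0 mW mgfW); rewrite ler_wpM2l ?(ltW lambda0)// gerBl.
have roots j : exists q, (forall k, 0 <= q k) /\
    conv_root (fun m => pr mu [set m%:R]) j.*2.+1 q.
  exact: (infinitely_divisible_conv_root idX muN mu0).
have [r rE] := ln_gen_fun_poly pG G0 GK roots.
apply: (mgf_inverse_not_exp_poly beta0 beta1 stableD t0).
exists (r \Po (1 - lambda^-1 *: 'X)) => y y0.
rewrite horner_comp -rE /G !hornerE; congr (ln (mgf _ _ _)).
by field; rewrite gt_eqF.
Qed.
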